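(* Let $T:S\to S$ be a step-isometry on a dense set $S$ in a reflexive Banach space $X$. Then $T$ extends uniquely to a step-isometry $\bar T:X\to X$ on the whole of $X$.
   Context: All normed spaces are real. Let $S$ be a dense set (in the norm topology) in a normed space $X$ (possibly $S=X$). A bijection $T:S\to S$ is a step-isometry (on $S$) if for all $x,y\in S$ we have $\lfloor\|x-y\|\rfloor=\lfloor\|T(x)-T(y)\|\rfloor$; equivalently, for every positive integer $k$ and all $x,y\in S$, $\|x-y\|<k$ if and only if $\|T(x)-T(y)\|<k$. *)

(* Defs.v *)
From HB Require Import structures.
From mathcomp Require Import all_boot all_order all_algebra.
From mathcomp Require Import all_classical all_reals all_analysis.

Set Implicit Arguments.
Unset Strict Implicit.
Unset Printing Implicit Defensive.

Import Order.TTheory GRing.Theory Num.Theory.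
Import numFieldNormedType.Exports.

Local Open Scope classical_set_scope.
Local Open Scope ring_scope.

Section dual_space.
Context {R : realType} (X : normedModType R).

Definition continuous_linear : {pred X -> R^o} :=
  [pred f : X -> R^o | `[< linear f /\ continuous f >]].

Lemma continuous_linearP (f : X -> R^o) :
  reflect (linear f /\ continuous f) (f \in continuous_linear).
Proof. exact: asboolP. Qed.

Lemma continuous_linear_submod_closed : submod_closed continuous_linear.
Proof.
split=> [|a f g /continuous_linearP[lf cf] /continuous_linearP[lg cg]].
  apply/continuous_linearP; split=> [a x y|x]; last exact: cvg_cst.
  by rewrite /= scaler0 addr0.
apply/continuous_linearP; split=> [b x y|x].
  rewrite !fctE lf lg !scalerDr !scalerA [b * a]mulrC -!addrA.
  by congr (_ + _); rewrite addrCA.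
by apply: cvgD; [apply: cvgZr; exact: cf|exact: cg].
Qed.

HB.instance Definition _ := GRing.isSubmodClosed.Build R (X -> R^o)
  continuous_linear continuous_linear_submod_closed.

Record dual := Dual {
  dual_fun :> X -> R^o;
  dual_funP : dual_fun \in continuous_linear }.

HB.instance Definition _ := [isSub for dual_fun].
HB.instance Definition _ := [Choice of dual by <:].
HB.instance Definition _ := [SubChoice_isSubLmodule of dual by <:].

Lemma dual_linear (f : dual) : linear f.
Proof. by case/continuous_linearP: (dual_funP f). Qed.

Lemma dual_continuous (f : dual) : continuous f.
Proof. by case/continuous_linearP: (dual_funP f). Qed.

HB.instance Definition _ (f : dual) :=
  GRing.isLinear.Build R X R^o _ f (dual_linear f).

Definition dual_norm (f : dual) : R :=
  sup [set `|f x| | x in [set x : X | `|x| <= 1]].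

Lemma dual_norm_has_sup (f : dual) :
  has_sup [set `|f x| | x in [set x : X | `|x| <= 1]].
Proof.
split; first by exists `|f 0|; exists 0 => //=; rewrite normr0.
have /linear_bounded_continuous/linear_boundedP : continuous f.
  exact: dual_continuous.
case=> M [_ /(_ (M + 1))]; rewrite ltrDl ltr01 => /(_ isT) fM.
exists `|M + 1| => _ [x /= x1 <-]; apply: le_trans (fM x) _.
apply: le_trans (ler_norm _) _; rewrite normrM normr_id.
by rewrite ler_piMr.
Qed.

Lemma dual_norm_ge0 (f : dual) : 0 <= dual_norm f.
Proof.
apply: le_trans (sup_upper_bound (dual_norm_has_sup f) _) => /=.
  exact: (normr_ge0 (f 0)).
by exists 0 => //=; rewrite normr0.
Qed.

Lemma ler_dual_norm (f : dual) (x : X) : `|f x| <= dual_norm f * `|x|.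
Proof.
have [->|x0] := eqVneq x 0; first by rewrite linear0 !normr0 mulr0.
have nx : 0 < `|x| by rewrite normr_gt0.
rewrite -ler_pdivrMr//.
apply: (sup_upper_bound (dual_norm_has_sup f)); exists (`|x|^-1 *: x) => /=.
  by rewrite normrZ normfV normr_id mulVf// gt_eqF.
by rewrite linearZ/= normrZ normfV normr_id mulrC.
Qed.

Lemma dual_norm_le (f : dual) (M : R) :
  0 <= M -> (forall x, `|f x| <= M * `|x|) -> dual_norm f <= M.
Proof.
move=> M0 fM; apply: ge_sup; first by case: (dual_norm_has_sup f).
move=> _ [x /= x1 <-]; apply: le_trans (fM x) _.
by rewrite ler_piMr.
Qed.

Lemma dual_normD (f g : dual) : dual_norm (f + g) <= dual_norm f + dual_norm g.
Proof.
apply: dual_norm_le => [|x]; first by rewrite addr_ge0// dual_norm_ge0.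
by rewrite mulrDl (le_trans (ler_normD _ _))// lerD// ler_dual_norm.
Qed.

Lemma dual_normZ_le (a : R) (f : dual) :
  dual_norm (a *: f) <= `|a| * dual_norm f.
Proof.
apply: dual_norm_le => [|x]; first by rewrite mulr_ge0// dual_norm_ge0.
by rewrite [X in `|X|](_ : _ = a *: f x)// normrZ -mulrA ler_wpM2l// ler_dual_norm.
Qed.

Lemma dual_normZ (a : R) (f : dual) : dual_norm (a *: f) = `|a| * dual_norm f.
Proof.
apply/eqP; rewrite eq_le dual_normZ_le/=.
have [->|a0] := eqVneq a 0; first by rewrite normr0 mul0r dual_norm_ge0.
rewrite -ler_pdivlMl ?normr_gt0// -normfV.
by apply: le_trans (dual_normZ_le _ _); rewrite scalerA mulVf// scale1r.
Qed.

Lemma dual_norm_eq0 (f : dual) : dual_norm f = 0 -> f = 0.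
Proof.
move=> f0; apply/val_inj/funext => x.
by have := ler_dual_norm f x; rewrite f0 mul0r normr_le0 => /eqP.
Qed.

HB.instance Definition _ := Lmodule_isNormed.Build R dual
  dual_normD dual_normZ dual_norm_eq0.

End dual_space.

Section reflexivity.
Context {R : realType} (X : normedModType R).

Lemma dual_eval_continuous_linear (x : X) :
  (fun f : dual X => f x : R^o) \in @continuous_linear R (dual X).
Proof.
pose ev f : R^o := (f : dual X) x.
have lev : linear ev by [].
pose L := GRing.isLinear.Build R (dual X) R^o _ ev lev.
pose evL : {linear dual X -> R^o} := HB.pack ev L.
apply/continuous_linearP; split => //.
suff : continuous evL by [].
apply/linear_bounded_continuous/linear_boundedP.
near=> r => f; apply: le_trans (ler_dual_norm f x) _.
by rewrite mulrC ler_wpM2r ?dual_norm_ge0//.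
Unshelve. all: by end_near. Qed.

Definition bidual_embedding (x : X) : dual (dual X) :=
  Dual (dual_eval_continuous_linear x).

Definition reflexive_space := set_surj setT setT bidual_embedding.

End reflexivity.

(* A self-map of S is represented by the restriction to S of a total function
   on X; its values outside S are irrelevant. *)
Definition step_isometry {R : realType} {X : normedModType R}
    (S : set X) (T : X -> X) :=
  set_bij S S T /\
  {in S &, forall x y, Num.floor `|x - y| = Num.floor `|T x - T y|}.

(* Main.v *)
(* Let F be a filter such that every z in S with |z - x| < 1 satisfies
   |z - p| < 1 for p eventually along F; then F converges to x. Indeed the limit
   points h of x - p then satisfy limsup |v + h| <= 1 on the whole unit ball.
   Testing with v almost norming a functional shows that h is weakly null; if h
   were not norm null, one could add up values of h to get bounded partial sums
   s_m and norming functionals F_m violating the double limit criterion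
   lim_m lim_i F_m (s_i) = lim_i lim_m F_m (s_i), which holds in reflexive spaces.

   In particular T and its inverse are continuous on S. For x in X, let u be a
   weak limit of T p as p tends to x. Weak lower semicontinuity gives
   |T z - u| <= 1 when |z - x| < 1, and continuity of the inverse makes it strict;
   so the convergence criterion applies at x to the inverse of T, and the inverse
   of T tends to x at u. Exchanging T and its inverse, T has a limit at each
   point; these limits form the extension. *)
From HB Require Import structures.
Require Import Defs.
From mathcomp Require Import all_boot all_order all_algebra.
From mathcomp Require Import all_classical all_reals all_analysis.
From mathcomp Require Import lra.

Set Implicit Arguments.
Unset Strict Implicit.
Unset Printing Implicit Defensive.

Import Order.TTheory GRing.Theory Num.Theory.
Import numFieldNormedType.Exports.

Local Open Scope classical_set_scope.

(** * The Hahn-Banach theorem through minimal sublinear functionals *)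

Section hahn_banach.
Local Open Scope ring_scope.
Context {R : realType} {V : lmodType R}.
Implicit Types (p q : V -> R) (x y z : V).

(** Applying the inequality to [t^-1] turns it into equality for [t > 0], so this is the usual
    positive homogeneity in the form easiest to check on infima. *)
Definition sublinear p :=
  (forall x y, p (x + y) <= p x + p y) /\
  (forall (t : R) x, 0 < t -> p (t *: x) <= t * p x).

Lemma sublinear0 p : sublinear p -> 0 <= p 0.
Proof. by case=> /(_ 0 0); rewrite addr0 => ? _; lra. Qed.

Lemma sublinear_geN p x : sublinear p -> - p (- x) <= p x.
Proof.
move=> sp; have := sublinear0 sp; case: sp => /(_ x (- x)) + _.
by rewrite subrr => ? ?; lra.
Qed.

(** Serves both the tilts and the chains in Zorn's lemma; [q3] takes the place of a common minorant
    of [q1] and [q2]. *)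
Lemma sublinear_inf (Q : set (V -> R)) q :
  Q q -> (forall x, has_lbound [set q x | q in Q]) ->
  (forall q1 q2 x y, Q q1 -> Q q2 ->
    exists2 q3, Q q3 & q3 (x + y) <= q1 x + q2 y) ->
  (forall q1 (t : R) x, Q q1 -> 0 < t ->
    exists2 q2, Q q2 & q2 (t *: x) <= t * q1 x) ->
  sublinear (fun x => inf [set q x | q in Q]).
Proof.
move=> Qq lb QD QZ.
have hi x : has_inf [set q x | q in Q] by split=> //; exists (q x); exists q.
have ge q' x : Q q' -> inf [set q x | q in Q] <= q' x.
  by move=> Qq'; apply: ge_inf => //; exists q'.
split=> [x y|t x t0].
  apply/ler_addgt0Pr => e e0.
  have e20 : 0 < e / 2 by lra.
  have [_ [q1 Qq1 <-] q1x] := inf_adherent e20 (hi x).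
  have [_ [q2 Qq2 <-] q2y] := inf_adherent e20 (hi y).
  have [q3 Qq3 ?] := QD _ _ x y Qq1 Qq2; have := ge q3 (x + y) Qq3; lra.
rewrite -ler_pdivrMl//; apply: lb_le_inf; first by exists (q x); exists q.
move=> _ [q1 Qq1 <-]; rewrite ler_pdivrMl//.
by have [q2 /(ge _ (t *: x)) le2 /(le_trans le2)] := QZ _ _ x Qq1 t0.
Qed.

(* A sublinear minorant of p whose value at - y is at most - p y; a minimal p
   coincides with all its tilts, which makes it additive. *)
Definition tilt p y x : R :=
  inf [set p (x + t *: y) - t * p y | t in [set t | 0 < t]].

Lemma has_lbound_tilt p y x : sublinear p ->
  has_lbound [set p (x + t *: y) - t * p y | t in [set t | 0 < t]].
Proof.
move=> sp; exists (- p (- x)) => _ [t /= t0 <-].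
have [pD pZ] := sp.
have := pZ t^-1 (t *: y); rewrite invr_gt0 scalerA mulVf ?gt_eqF// scale1r.
move=> /(_ t0); rewrite ler_pdivlMl// => h.
by have := pD (x + t *: y) (- x); rewrite addrAC subrr add0r; lra.
Qed.

Lemma tilt_le p y x (t : R) : sublinear p -> 0 < t ->
  tilt p y x <= p (x + t *: y) - t * p y.
Proof. by move=> sp t0; apply: ge_inf; [exact: has_lbound_tilt|exists t]. Qed.

Lemma tilt_le_id p y x : sublinear p -> tilt p y x <= p x.
Proof.
move=> sp; apply: le_trans (tilt_le _ _ sp ltr01) _.
by have := sp.1 x y; rewrite scale1r; lra.
Qed.

Lemma tilt_sublinear p y : sublinear p -> sublinear (tilt p y).
Proof.
move=> sp; pose Q := [set (fun x => p (x + t *: y) - t * p y) | t in [set t | 0 < t]].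
have QE x : [set q x | q in Q] =
    [set p (x + t *: y) - t * p y | t in [set t | 0 < t]].
  by rewrite /Q image_comp.
suff : sublinear (fun x => inf [set q x | q in Q]).
  by congr sublinear; apply/funext => x; rewrite QE.
apply: (@sublinear_inf _ (fun x => p (x + 1 *: y) - 1 * p y)).
- by exists 1 => //=.
- by move=> x; rewrite QE; exact: has_lbound_tilt.
- move=> _ _ x z [s /= s0 <-] [t /= t0 <-].
  exists (fun x => p (x + (s + t) *: y) - (s + t) * p y).
    by exists (s + t) => //=; lra.
  have := sp.1 (x + s *: y) (z + t *: y); rewrite addrACA -scalerDl; lra.
- move=> _ t x [s /= s0 <-] t0.
  exists (fun x => p (x + (t * s) *: y) - (t * s) * p y).
    by exists (t * s) => //=; rewrite mulr_gt0.
  by rewrite mulrBr -scalerA -scalerDr mulrA lerB// sp.2.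
Qed.

Lemma minimal_sublinear_linear p : sublinear p ->
  (forall q, sublinear q -> (forall x, q x <= p x) -> q = p) ->
  linear (p : V -> R^o).
Proof.
move=> sp pmin.
have pD x y : p (x + y) = p x + p y.
  apply/eqP; rewrite eq_le sp.1/=.
  (* Minimality gives [tilt p y = p], and the tilt at [t = 1] yields [p x <= p (x + y) - p y], the
     converse of subadditivity. *)
  rewrite -[in X in X + _](pmin _ (tilt_sublinear y sp)); last first.
    by move=> z; exact: tilt_le_id.
  by have := tilt_le y x sp ltr01; rewrite scale1r; lra.
have p0 : p 0 = 0 by have := pD 0 0; rewrite addr0; lra.
have pN x : p (- x) = - p x by have := pD x (- x); rewrite subrr p0; lra.
have pZ_gt0 (t : R) x : 0 < t -> p (t *: x) = t * p x.
  move=> t0; apply/eqP; rewrite eq_le sp.2//=.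
  by have := sp.2 t (- x) t0; rewrite scalerN !pN; lra.
move=> t x y; rewrite pD; congr (_ + _).
suff : p (t *: x) = t * p x by [].
case: (ltgtP t 0) => [t0|/pZ_gt0//|->].
  by rewrite -[in LHS](opprK t) scaleNr pN pZ_gt0 ?oppr_gt0// mulNr opprK.
by rewrite scale0r p0 mul0r.
Qed.

(** Zorn's lemma for the reversed pointwise order. Every sublinear minorant of [p] is at least
    [- p (- x)] at [x], so the infimum of a nonempty chain is finite. *)
Lemma exists_minimal_sublinear p : sublinear p ->
  exists2 q, sublinear q & (forall x, q x <= p x) /\
    (forall q', sublinear q' -> (forall x, q' x <= q x) -> q' = q).
Proof.
move=> sp; pose D_pred q := sublinear q /\ forall x, q x <= p x.
pose D := {q | D_pred q}.
pose r (a b : D) := `[< forall x, sval b x <= sval a x >].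
have [a amax] : exists a, forall b, r a b -> b = a.
  apply: Zorn.
  - by move=> a; apply/asboolP.
  - move=> a b c /asboolP ab /asboolP bc; apply/asboolP => x.
    exact: le_trans (bc x) (ab x).
  - move=> [a sa] [b sb] /asboolP/= ab /asboolP/= ba; apply: eq_exist; apply/funext => x.
    by apply/eqP; rewrite eq_le ba ab.
  move=> A Atot; have [[a Aa]|A0] := pselect (A !=set0); last first.
    exists (exist _ p (conj sp (fun x => lexx _))) => s As.
    by exfalso; apply: A0; exists s.
  pose Q := [set sval b | b in A].
  have lb x : has_lbound [set q x | q in Q].
    exists (- p (- x)) => _ [_ [[q [sq qp]] _ <-] <-] /=.
    by have := sublinear_geN x sq; have := qp (- x); lra.
  have leQ b x : A b -> inf [set q x | q in Q] <= sval b x.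
    by move=> Ab; apply: ge_inf => //; exists (sval b) => //; exists b.
  have sQ : sublinear (fun x => inf [set q x | q in Q]).
    apply: (@sublinear_inf _ (sval a)) => //.
    - by exists a.
    - move=> _ _ x y [b Ab <-] [c Ac <-].
      have [/asboolP bc|/asboolP cb] := Atot _ _ Ab Ac.
        exists (sval c); first by exists c.
        by apply: le_trans ((svalP c).1.1 _ _) _; rewrite lerD2r.
      exists (sval b); first by exists b.
      by apply: le_trans ((svalP b).1.1 _ _) _; rewrite lerD2l.
    - move=> _ t x [b Ab <-] t0; exists (sval b); first by exists b.
      exact: (svalP b).1.2.
  have Qp x : inf [set q x | q in Q] <= p x.
    by apply: le_trans (leQ a x Aa) _; exact: (svalP a).2.
  by exists (exist D_pred _ (conj sQ Qp)) => b Ab; apply/asboolP => x; exact: leQ.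
case: a amax => q [sq qp] qmax; exists q => //; split=> // q' sq' q'q.
have q'p x : q' x <= p x by apply: le_trans (qp x).
by have /(_ (asboolT q'q))[] := qmax (exist D_pred q' (conj sq' q'p)).
Qed.

(** A minimal functional [f] below [tilt p y] is linear and satisfies
    [f (- y) <= p 0 - p y <= - p y], that is [p y <= f y]. *)
Lemma hahn_banach p y : sublinear p ->
  exists2 f : V -> R^o, linear f & (forall x, f x <= p x) /\ p y <= f y.
Proof.
move=> sp.
have [f sf [fp fmin]] := exists_minimal_sublinear (tilt_sublinear y sp).
have lf := minimal_sublinear_linear sf fmin.
pose F := GRing.isLinear.Build R V R^o _ f lf.
pose fL : {linear V -> R^o} := HB.pack f F.
have fN x : f (- x) = - f x by exact: (linearN fL _).
exists f => //; split=> [x|]; first exact: le_trans (fp x) (tilt_le_id _ _ sp).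
have p0 : p 0 <= 0.
  have h : 0 < 2^-1 :> R by rewrite invr_gt0.
  by have := sp.2 _ 0 h; rewrite scaler0; lra.
have := le_trans (fp (- y)) (tilt_le y _ sp ltr01).
by rewrite scale1r addNr fN; lra.
Qed.

End hahn_banach.

(** * Norming functionals *)

Section norming.
Local Open Scope ring_scope.
Context {R : realType} {X : normedModType R}.

Lemma bounded_linear_dual (f : X -> R^o) (C : R) : linear f ->
  (forall x, `|f x| <= C * `|x|) -> f \in @continuous_linear R X.
Proof.
move=> lf fC; pose F := GRing.isLinear.Build R X R^o _ f lf.
pose fL : {linear X -> R^o} := HB.pack f F.
apply/continuous_linearP; split=> //.
suff : continuous fL by [].
apply/linear_bounded_continuous/linear_boundedP.
near=> r => x; apply: le_trans (fC x) _.
by rewrite ler_wpM2r.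
Unshelve. all: by end_near. Qed.

Lemma norming_functional (x : X) :
  exists2 f : dual X, dual_norm f <= 1 & f x = `|x|.
Proof.
have sn : @sublinear R X (fun x => `|x|).
  split=> [y z|t y t0]; first exact: ler_normD.
  by rewrite normrZ gtr0_norm.
have [f lf [fn xf]] := hahn_banach x sn.
pose F := GRing.isLinear.Build R X R^o _ f lf.
pose fL : {linear X -> R^o} := HB.pack f F.
have nf y : `|f y| <= 1 * `|y|.
  have fN : f (- y) = - f y by exact: (linearN fL _).
  by rewrite mul1r ler_norml fn andbT lerNl -(normrN y) -fN fn.
exists (Dual (bounded_linear_dual lf nf)); first exact: dual_norm_le.
by apply/eqP; rewrite eq_le fn xf.
Qed.

End norming.

(** * Weak limits along ultrafilters *)

Section ultralimits.
Local Open Scope ring_scope.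
Context {R : realType} {A : Type} (U : set_system A) {UU : UltraFilter U}.

(** By compactness of [[- C, C]] the image has a cluster point, and an ultrafilter converges to each
    of its cluster points. *)
Lemma ultra_bounded_cvg (f : A -> R) (C : R) :
  (\forall a \near U, `|f a| <= C) -> exists l : R, f @ U --> l.
Proof.
move=> fC; have fU : (f @ U) `[- C, C]%classic.
  by near=> a; rewrite /= in_itv/= -ler_norml; near: a.
have [l [_ fl]] := @segment_compact _ _ _ _ _ fU.
exists l; apply/cvgrPdist_lt => e e0.
have [//|Ue] := in_ultra_setVsetC [set a | `|l - f a| < e] UU.
have [|y [/= + ly]] := fl (~` [set y | `|l - y| < e]) _ _ (nbhsx_ballx l e e0).
  exact: Ue.
by [].
Unshelve. all: by end_near. Qed.

(** Banach-Alaoglu in ultrafilter form: the pointwise limits exist, are linear and inherit the bound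
    [C]. *)
Lemma dual_ultra_cvg (X : normedModType R) (F : A -> dual X) (C : R) :
  (\forall a \near U, dual_norm (F a) <= C) ->
  exists G : dual X, forall x, F a x @[a --> U] --> (G x : R).
Proof.
move=> FC.
have FxC x : \forall a \near U, `|F a x| <= C * `|x|.
  by near=> a; apply: le_trans (ler_dual_norm _ _) _; rewrite ler_wpM2r//; near: a.
have /choice[g gE] x := ultra_bounded_cvg (FxC x).
have lg : linear (g : X -> R^o).
  move=> t x y.
  apply: (@cvg_unique _ (@Rhausdorff R) (F a (t *: x + y) @[a --> U])) (gE _) _.
  rewrite [X in X @ _](_ : _ = (fun a => t * F a x + F a y)); last first.
    by apply/funext => a; rewrite linearP.
  by apply: cvgD; [apply: cvgM; [exact: cvg_cst|exact: gE]|exact: gE].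
have gC x : `|g x| <= C * `|x|.
  exact: (closed_cvg _ (@closed_le _ _) (FxC x) _ (cvg_norm (gE x))).
by exists (Dual (bounded_linear_dual lg gC)).
Unshelve. all: by end_near. Qed.

(** The images of the [p a] in the bidual have a weak-* limit, which reflexivity represents by a
    point of [X]. *)
Lemma reflexive_weak_ultra_cvg (X : normedModType R) (p : A -> X) (C : R) :
  reflexive_space X -> (\forall a \near U, `|p a| <= C) ->
  exists u : X, forall f : dual X, f (p a) @[a --> U] --> (f u : R).
Proof.
move=> reflX pC; have [|G GE] := @dual_ultra_cvg (dual X) (@bidual_embedding R X \o p) C.
  near=> a; apply: (@le_trans _ _ `|p a|); last by near: a.
  apply: dual_norm_le => // f; rewrite mulrC; exact: (ler_dual_norm f (p a)).
by have [u _ uG] := reflX G I; exists u => f; have := GE f; rewrite -uG.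
Unshelve. all: by end_near. Qed.

End ultralimits.

Lemma near_forall_in_seq (T : Type) (F : set_system T) {FF : Filter F}
    (I : eqType) (P : I -> T -> Prop) (s : seq I) :
  (forall i, i \in s -> \forall t \near F, P i t) ->
  \forall t \near F, forall i, i \in s -> P i t.
Proof.
elim: s => [|i s IHs] sP; first exact: nearW.
have Ps : \forall t \near F, forall j, j \in s -> P j t.
  by apply: IHs => j js; apply: sP; rewrite inE js orbT.
apply: filterS2 (sP i (mem_head i s)) Ps => t Pi Ps j.
by rewrite inE => /predU1P[->|/Ps].
Qed.

(** * From the unit ball condition to weak and then norm convergence to zero *)

Section weakly_null_ultrafilter.
Local Open Scope ring_scope.
Context {R : realType} {X : normedModType R}.
Context (U : set_system X) {UU : UltraFilter U}.
Hypothesis near_unit_ball : forall (v : X) (d : R), `|v| <= 1 -> 0 < d ->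
  \forall h \near U, `|v + h| < 1 + d.

(** Keeps the partial sums bounded. For [|s| > 1] and [v] the unit vector along [s], [|s + h|] is at
    most [|v + h| + (|s| - 1)], and [d = 2 - |s|] is the slack left. *)
Lemma near_ball2 (s : X) : `|s| < 2 -> \forall h \near U, `|s + h| < 2.
Proof.
move=> s2; have [s1|s1] := leP `|s| 1.
  by near=> h; have : `|s + h| < 1 + 1; [near: h; exact: near_unit_ball|lra].
pose v := `|s|^-1 *: s.
have v1 : `|v| <= 1.
  by rewrite normrZ normfV normr_id mulVf// gt_eqF//; lra.
have d0 : 0 < 2 - `|s| by lra.
near=> h.
have -> : s + h = (v + h) + (s - v) by rewrite (addrC v) -addrA (addrCA v) subrr addr0 addrC.
have sv : `|s - v| = `|s| - 1.
  rewrite -[X in X - _](scale1r s) -scalerBl normrZ ger0_norm.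
    by rewrite mulrBl mul1r mulVf// gt_eqF//; lra.
  by rewrite subr_ge0 invf_le1; lra.
apply: le_lt_trans (ler_normD _ _) _; rewrite sv.
by have : `|v + h| < 1 + (2 - `|s|); [near: h; exact: near_unit_ball|lra].
Unshelve. all: by end_near. Qed.

Lemma near_weak0 (f : dual X) : f h @[h --> U] --> (0 : R).
Proof.
apply/cvgrPdist_lt => e e0.
have [v v1 fv] : exists2 v, `|v| <= 1 & dual_norm f - e / 2 < f v.
  have e20 : 0 < e / 2 by lra.
  have [_ [v /= v1 <-] fv] := sup_adherent e20 (dual_norm_has_sup f).
  have [f0|f0] := leP 0 (f v : R); first by exists v => //; rewrite -(ger0_norm f0).
  by exists (- v); rewrite ?normrN// linearN -(ltr0_norm f0).
have N0 := dual_norm_ge0 f.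
(* The [+ 1] keeps the denominator positive when [f = 0]. Evaluating [f] at [v + h] and [- v + h]
   bounds [f h] on both sides. *)
pose d := e / 2 / (dual_norm f + 1).
have d0 : 0 < d by rewrite !divr_gt0//; lra.
have Nd : dual_norm f * d <= e / 2.
  by rewrite /d mulrA ler_pdivrMr; nra.
have nv1 : `|- v| <= 1 by rewrite normrN.
near=> h; rewrite sub0r normrN.
have vh : `|v + h| < 1 + d by near: h; exact: near_unit_ball.
have nvh : `|- v + h| < 1 + d by near: h; exact: near_unit_ball.
have := ler_dual_norm f (v + h); have := ler_dual_norm f (- v + h).
rewrite !linearD linearN !ler_norml ltr_norml => /andP[? _] /andP[_ ?].
have := ler_wpM2l N0 (ltW vh); have := ler_wpM2l N0 (ltW nvh).
by rewrite !mulrDr; lra.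
Unshelve. all: by end_near. Qed.

Lemma reflexive_near_norm_small (e : R) : reflexive_space X -> 0 < e ->
  \forall h \near U, `|h| < e.
Proof.
move=> reflX e0; have [//|Ue] := in_ultra_setVsetC [set h | `|h| < e] UU.
exfalso.
have {}Ue : \forall h \near U, e <= `|h|.
  by apply: filterS Ue => h /=; rewrite leNgt => /negP.
(* [N h] norms [h], and [f] will be the weak-* limit of [N h]; the functionals [N h - f] are then
   pointwise null along [U], with norm at most 2. *)
have /choice[N NP] (x : X) : exists f : dual X, dual_norm f <= 1 /\ f x = `|x|.
  by have [f] := norming_functional x; exists f.
have [f fE] : exists f : dual X, forall x, N h x @[h --> U] --> (f x : R).
  by apply: (@dual_ultra_cvg _ _ _ _ _ _ 1); near=> h; exact: (NP h).1.
have nf : dual_norm f <= 1.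
  apply: dual_norm_le => // x.
  apply: (closed_cvg _ (@closed_le _ _) _ _ (cvg_norm (fE x))).
  near=> h; apply: le_trans (ler_dual_norm _ _) _.
  by rewrite ler_wpM2r// (NP h).1.
(* A state is the last partial sum and the list of all pairs (s_i, F_i) so far. *)
pose I (st : X * seq (X * dual X)) :=
  `|st.1| < 2 /\ forall q, q \in st.2 -> e / 2 < q.2 st.1.
have step st : I st -> exists p : X * dual X, [/\ I (p.1, p :: st.2),
    dual_norm p.2 <= 2 & forall q, q \in st.2 -> p.2 q.1 < e / 4].
  case: st => s l [/= s2 ls].
  have Nf0 x : (N h - f) x @[h --> U] --> (0 : R).
    rewrite -(subrr (f x : R)).
    by apply: cvgB; [exact: fE|exact: cvg_cst].
  have near_l : \forall h \near U, forall q, q \in l -> e / 2 < q.2 (s + h).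
    apply: near_forall_in_seq => q /ls qs.
    have : q.2 (s + h) @[h --> U] --> (q.2 s + 0 : R).
      rewrite [X in X @ _](_ : _ = (fun h => q.2 s + q.2 h)); last first.
        by apply/funext => h; rewrite linearD.
      by apply: cvgD; [exact: cvg_cst|exact: near_weak0].
    by rewrite addr0 => /cvgr_gt; apply.
  have near_N : \forall h \near U,
      forall q, q \in l -> (N h - f) q.1 < e / 4.
    apply: near_forall_in_seq => q ql.
    by apply: (cvgr_lt _ (Nf0 q.1)); lra.
  have near_s : \forall h \near U, (N h - f) s > - (e / 4).
    by apply: (cvgr_gt _ (Nf0 s)); lra.
  have near_f : \forall h \near U, (f h : R) < e / 4.
    by apply: (cvgr_lt _ (near_weak0 f)); lra.
  have near2 := near_ball2 s2.
  (* For such [h] the new functional [N h - f] exceeds [- e / 4 + (e - e / 4) = e / 2] at [s + h]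
     and is below [e / 4] at all earlier sums, while the old functionals stay above [e / 2] at
     [s + h]. *)
  have [h [[Nl fs] [sl [s2h [fh eh]]]]] := filter_ex (filterI (filterI near_N near_s)
    (filterI near_l (filterI near2 (filterI near_f Ue)))).
  exists (s + h, N h - f); split => //=.
  - split=> // q; rewrite inE => /predU1P[->|/sl//].
    rewrite [ltRHS](_ : _ = (N h - f) (s + h))//.
    have -> : (N h - f) (s + h) = (N h - f) s + (N h - f) h :> R by exact: linearD.
    have : (N h - f) h = `|h| - f h :> R by rewrite -(NP h).2.
    by move=> ->; lra.
  - apply: le_trans (dual_normD _ _) _.
    rewrite -scaleN1r dual_normZ normrN1 mul1r.
    by have := (NP h).1; lra.
pose D := {st | I st}.
have I0 : I (0, [::]) by split; rewrite /= ?normr0.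
have /choice[next nextP] (d : D) : exists d' : D, exists p : X * dual X,
    [/\ sval d' = (p.1, p :: (sval d).2),
    dual_norm p.2 <= 2 & forall q, q \in (sval d).2 -> p.2 q.1 < e / 4].
  have [p [Ip ? ?]] := step _ (svalP d).
  by exists (exist I _ Ip), p.
pose st n := iter n next (exist I _ I0).
have /choice[p pP] n := nextP (st n).
have mem_st i n : (i < n)%N -> p i \in (sval (st n)).2.
  elim: n => // n IHn; rewrite ltnS leq_eqVlt => /predU1P[->|/IHn];
    by have [/= -> _ _] := pP n; rewrite inE ?eqxx// => ->; rewrite orbT.
have p_ge i n : (i <= n)%N -> e / 2 < (p i).2 (p n).1.
  move=> /(mem_st i n.+1); have [stE _ _] := pP n.
  by have := (svalP (st n.+1)).2 (p i); rewrite stE /=.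
have p_le i n : (i < n)%N -> (p n).2 (p i).1 < e / 4.
  by move=> /mem_st; have [_ _ h] := pP n; exact: h.
have p1 n : `|(p n).1| <= 2.
  by have := (svalP (st n.+1)).1; have [-> _ _] := pP n => /ltW.
(* With [s] and [G] the limits along [V] of the sums and of the functionals, the two iterated limits
   both equal [G s], which is thus at least [e / 2] and at most [e / 4]. *)
have [V [VU subV]] := @ultraFilterLemma _ (nbhs \oo) _.
have [s sE] : exists s, forall g : dual X, g (p n).1 @[n --> V] --> (g s : R).
  by apply: (@reflexive_weak_ultra_cvg _ _ _ _ _ _ 2) => //; near=> n.
have [G GE] : exists G : dual X, forall x, (p n).2 x @[n --> V] --> (G x : R).
  by apply: (@dual_ultra_cvg _ _ _ _ _ _ 2); near=> n; have [] := pP n.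
have nearV (P : nat -> Prop) n : (forall k, (n <= k)%N -> P k) -> \forall k \near V, P k.
  by move=> nP; apply: subV; exists n.
have ge_s : e / 2 <= G s.
  apply: (closed_cvg _ (@closed_ge _ _) _ _ (GE s)); near=> i.
  apply: (closed_cvg _ (@closed_ge _ _) _ _ (sE (p i).2)).
  by apply: (@nearV _ i) => n /p_ge/ltW.
have le_s : G s <= e / 4.
  apply: (closed_cvg _ (@closed_le _ _) _ _ (sE G)); near=> n.
  apply: (closed_cvg _ (@closed_le _ _) _ _ (GE (p n).1)).
  by apply: (@nearV _ n.+1) => i /p_le/ltW.
by have := le_trans ge_s le_s; lra.
Unshelve. all: by end_near. Qed.

End weakly_null_ultrafilter.

Lemma dense_ball (R : realType) (X : normedModType R) (S : set X) (x : X) (e : R) :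
  dense S -> (0 < e)%R -> exists2 p, S p & (`|p - x| < e)%R.
Proof.
move=> dS e0; have [|p [xp Sp]] := dS (ball x e) _ (ball_open x e).
  by exists x; exact: ballxx.
by exists p => //; move: xp; rewrite -ball_normE/= distrC.
Qed.

(** * The convergence criterion by unit balls *)

Section convergence_from_unit_balls.
Local Open Scope ring_scope.
Context {R : realType} {X : normedModType R}.

Lemma unit_balls_cvg (S : set X) (F : set_system X) {FF : ProperFilter F} (x : X) :
  reflexive_space X -> dense S ->
  (forall z, S z -> `|z - x| < 1 -> \forall p \near F, `|z - p| < 1) ->
  F --> x.
Proof.
move=> reflX dS SF; apply/cvgrPdist_lt => e e0.
apply: contrapT => nFe.
(* Failure of convergence is exactly what makes the restriction of [F] to points at distance at
   least [e] from [x] proper. *)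
have FE : ProperFilter (within [set p | e <= `|x - p|] F).
  apply: Build_ProperFilter_ex => A FA; apply: contrapT => nA; apply: nFe.
  have {}FA : F [set p | e <= `|x - p| -> A p] := FA.
  apply: filterS FA => p /= ep; rewrite ltNge; apply/negP => /ep Ap.
  by apply: nA; exists p.
have FX : ProperFilter ((fun p => x - p) @ within [set p | e <= `|x - p|] F).
  exact: fmap_proper_filter.
have [U [UU FU]] := ultraFilterLemma FX.
suff Ue : \forall h \near U, `|h| < e.
  have : U [set h | e <= `|h|].
    by apply: FU; exact: (@filterE _ F).
  by move=> /(filterI Ue)/filter_ex[h [/= ? ?]]; lra.
apply: reflexive_near_norm_small => // v d v1 d0.
(* Shrinking [v] by the factor [1 - c] leaves room to approximate by [z] in [S] and keep
   [|z - x| < 1]. The total error is below [c + c / 2 < d]; the minimum with 1 keeps [1 - c]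
   nonnegative. *)
have [z Sz zxv] : exists2 z, S z & `|z - (x + (1 - Num.min (d / 4) 1) *: v)| < Num.min (d / 4) 1 / 2.
  by apply: dense_ball => //; rewrite divr_gt0// lt_min ltr01 andbT divr_gt0.
set c := Num.min (d / 4) 1 in zxv.
have cd : c <= d / 4 by rewrite ge_min lexx.
have c1 : c <= 1 by rewrite ge_min lexx orbT.
have c0 : 0 < c by rewrite lt_min ltr01 andbT divr_gt0.
set w := x + _ in zxv.
have wx : `|w - x| <= 1 - c.
  rewrite /w addrAC subrr add0r normrZ ger0_norm; last lra.
  by rewrite ler_piMr//; lra.
have zx : `|z - x| < 1.
  by have := ler_normD (z - w) (w - x); rewrite subrKA; lra.
have wv : `|x + v - w| <= c.
  rewrite /w opprD addrACA subrr add0r -[X in X - _]scale1r -scalerBl.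
  have -> : 1 - (1 - c) = c by lra.
  by rewrite normrZ gtr0_norm// ler_piMr//; lra.
apply: FU; rewrite /fmap/within/=.
apply: filterS (SF z Sz zx) => p zp _ /=.
have -> : v + (x - p) = (x + v - w) + (w - z) + (z - p).
  by rewrite !subrKA addrCA addrA.
have := ler_normD (x + v - w + (w - z)) (z - p).
have := ler_normD (x + v - w) (w - z); rewrite (distrC w z).
by lra.
Qed.

End convergence_from_unit_balls.

(** * Limits of step-isometries and the extension *)

Section step_inverse.
Local Open Scope ring_scope.
Context {R : realType} {X : normedModType R}.
Implicit Types (S : set X) (T : X -> X).

(** The inverse is explicit so that [T] and [T'] can be exchanged, and comparisons with naturals
    replace floors. *)
Definition step_inverse S T T' := [/\
  forall x, S x -> S (T x), forall x, S x -> S (T' x),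
  forall x, S x -> T' (T x) = x, forall x, S x -> T (T' x) = x &
  forall (k : nat) x y, S x -> S y -> (`|x - y| < k%:R) = (`|T x - T y| < k%:R)].

Lemma step_inverse_sym S T T' : step_inverse S T T' -> step_inverse S T' T.
Proof.
case=> ST ST' TK T'K Tk; split=> // k x y Sx Sy.
by rewrite [RHS]Tk ?T'K//; exact: ST'.
Qed.

Lemma floor_eqP (a b : R) : 0 <= a -> 0 <= b ->
  (forall k : nat, (a < k%:R) = (b < k%:R)) <-> Num.floor a = Num.floor b.
Proof.
move=> a0 b0; split=> [ab|ab k]; last first.
  by rewrite -[k%:R]/(k%:Z%:~R) -!floor_lt_int ab.
have le (c d : R) : 0 <= d -> (forall k : nat, (c < k%:R) = (d < k%:R)) ->
    Num.floor c <= Num.floor d.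
  move=> d0 cd; rewrite -ltzD1 floor_lt_int.
  have : 0 <= Num.floor d + 1 by rewrite addr_ge0 ?floor_ge0.
  case: (Num.floor d + 1) (floorD1_gt d) => // k dk _.
  by have := cd k; rewrite -[k%:R]/(k%:Z%:~R) dk.
by apply/eqP; rewrite eq_le !le.
Qed.

Lemma step_isometry_inverse S T : step_isometry S T <->
  exists T', step_inverse S T T'.
Proof.
split=> [[[Tf Ti Ts] Tk]|[T' [ST ST' TK T'K Tk]]].
  have /choice[T' T'P] (y : X) : exists x, S y -> S x /\ T x = y.
    (* [0] is a default witness for [y] outside [S]. *)
    by have [/Ts[x Sx <-]|] := pselect (S y); [exists x|exists 0].
  exists T'; split.
  - by move=> x Sx; exact: Tf.
  - by move=> x /T'P[].
  - move=> x Sx; have [? ?] := T'P _ (Tf _ Sx).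
    by apply: Ti; rewrite ?inE.
  - by move=> x /T'P[].
  - move=> k x y Sx Sy; apply: (floor_eqP (normr_ge0 _) (normr_ge0 _)).2.
    by apply: Tk; rewrite inE.
split; last by move=> x y; rewrite !inE => Sx Sy; apply/floor_eqP => // k; exact: Tk.
split.
- exact: ST.
- by move=> x y; rewrite !inE => Sx Sy xy; rewrite -(TK x Sx) xy TK.
- by move=> y Sy; exists (T' y); [exact: ST'|exact: T'K].
Qed.

Definition limit_within S T (x u : X) := T p @[p --> within S (nbhs x)] --> u.

Lemma within_dense_proper S (x : X) : dense S -> ProperFilter (within S (nbhs x)).
Proof.
move=> dS; apply: Build_ProperFilter_ex => A /nbhs_ballP[e /= e0 eA].
have [p Sp px] := dense_ball x dS e0.
by exists p; apply: eA => //; rewrite -ball_normE/= distrC.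
Qed.

Lemma limit_withinP S T x u : limit_within S T x u <->
  forall e : R, 0 < e -> exists2 d : R, 0 < d &
    forall p, S p -> `|p - x| < d -> `|T p - u| < e.
Proof.
split=> [/cvgrPdist_lt Txu e /Txu/nbhs_ballP[d /= d0 dT]|Txu].
  exists d => // p Sp px; rewrite distrC; apply: dT => //.
  by rewrite -ball_normE/= distrC.
apply/cvgrPdist_lt => e /Txu[d d0 dT]; apply/nbhs_ballP; exists d => //= p.
by rewrite -ball_normE/= distrC => px Sp; rewrite /= distrC; exact: dT.
Qed.

Context {S : set X} (reflX : reflexive_space X) (dS : dense S).

(** If [w] in [S] is within 1 of [T x], then [T' w] is within 1 of [x], hence of every [p] near [x],
    so [w] is within 1 of [T p]: the unit ball criterion applies. *)
Lemma step_inverse_continuous T T' x : step_inverse S T T' -> S x ->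
  limit_within S T x (T x).
Proof.
move=> [ST ST' TK T'K Tk] Sx.
have PF := within_dense_proper x dS.
apply: (unit_balls_cvg reflX dS) => w Sw wx.
have {}wx : `|T' w - x| < 1.
  by have := Tk 1%N _ _ (ST' _ Sw) Sx; rewrite T'K// wx.
have d0 : 0 < 1 - `|T' w - x| by lra.
rewrite /fmap/=; apply/nbhs_ballP; exists (1 - `|T' w - x|) => //= p.
rewrite -ball_normE/= => xp Sp /=.
have := Tk 1%N _ _ (ST' _ Sw) Sp; rewrite T'K// => <-.
by have := ler_normD (T' w - x) (x - p); rewrite subrKA; lra.
Qed.

Lemma step_inverse_limit T T' x : step_inverse S T T' ->
  exists u, limit_within S T' u x.
Proof.
move=> TT'; have [ST ST' TK T'K Tk] := TT'.
have PF := within_dense_proper x dS.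
have FF : ProperFilter (T @ within S (nbhs x)) by exact: fmap_proper_filter.
have [U [UU FU]] := ultraFilterLemma FF.
have nearU z : S z -> `|z - x| < 1 -> \forall p \near U, `|T z - p| < 1.
  move=> Sz zx; apply: FU; rewrite /fmap/=; apply/nbhs_ballP.
  exists (1 - `|z - x|) => /=; first lra.
  move=> p; rewrite -ball_normE/= => xp Sp /=.
  have := Tk 1%N _ _ Sz Sp => <-.
  by have := ler_normD (z - x) (x - p); rewrite subrKA; lra.
have [z0 Sz0 z0x] := dense_ball x dS ltr01.
have [u uE] : exists u, forall f : dual X, f p @[p --> U] --> (f u : R).
  apply: (@reflexive_weak_ultra_cvg _ _ _ _ _ id (`|T z0| + 1)) => //.
  near=> p; have : `|T z0 - p| < 1 by near: p; exact: nearU.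
  have := ler_normD (p - T z0) (T z0); rewrite subrK (distrC p); lra.
have weak z : S z -> `|z - x| < 1 -> `|T z - u| <= 1.
  move=> Sz zx; have [f f1 <-] := norming_functional (T z - u).
  rewrite linearB.
  apply: (closed_cvg _ (@closed_le _ (1 : R)) _ _ (cvgB (cvg_cst (f (T z) : R)) (uE f))).
  near=> p; have zp : `|T z - p| < 1 by near: p; exact: nearU.
  have N1 : dual_norm f * `|T z - p| <= 1.
    by rewrite mulr_ile1// ?dual_norm_ge0// ltW.
  apply: (@le_trans _ _ (f (T z - p))); first by rewrite linearB.
  exact: le_trans (ler_norm _) (le_trans (ler_dual_norm _ _) N1).
exists u.
have strict z : S z -> `|z - x| < 1 -> `|T z - u| < 1.
  move=> Sz zx; rewrite lt_neqAle weak// andbT; apply/eqP => Tzu.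
  have /limit_withinP := step_inverse_continuous (step_inverse_sym TT') (ST z Sz).
  rewrite TK// => /(_ (1 - `|z - x|))[|d d0 dT']; first lra.
  have d20 : 0 < d / 2 by lra.
  (* a point of S slightly beyond T z on the ray from u *)
  have [w Sw wT] := dense_ball (T z + (d / 2) *: (T z - u)) dS d20.
  have wz : `|w - T z| < d.
    have := ler_normD (w - (T z + (d / 2) *: (T z - u))) ((d / 2) *: (T z - u)).
    rewrite normrZ Tzu gtr0_norm// => h.
    by rewrite (_ : w - T z = w - (T z + d / 2 *: (T z - u)) + d / 2 *: (T z - u));
      [lra|rewrite opprD addrA subrK].
  have T'wz := dT' _ Sw wz.
  have := weak _ (ST' _ Sw); rewrite T'K// => /(_ _).
  have T'wx : `|T' w - x| < 1.
    by have := ler_normD (T' w - z) (z - x); rewrite subrKA; lra.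
  move=> /(_ T'wx) wu.
  (* The ray point is at distance [1 + d / 2] from [u] and [w] is less than [d / 2] from it, so
     [|w - u| > 1], against [wu]. *)
  have : (1 + d / 2) * `|T z - u| <= `|w - u| + `|w - (T z + d / 2 *: (T z - u))|.
    rewrite -[X in X * _]ger0_norm; last lra.
    rewrite -normrZ scalerDl scale1r [leRHS]addrC (distrC w (_ + _)).
    by apply: le_trans (ler_normD _ _); rewrite subrKA addrAC.
  by rewrite Tzu; lra.
have PFu := within_dense_proper u dS.
apply: (unit_balls_cvg reflX dS) => z Sz /(strict _ Sz) zu.
rewrite /fmap/=; apply/nbhs_ballP; exists (1 - `|T z - u|) => /=; first lra.
move=> y; rewrite -ball_normE/= => uy Sy /=.
have := Tk 1%N _ _ Sz (ST' _ Sy); rewrite T'K// => ->.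
by have := ler_normD (T z - u) (u - y); rewrite subrKA; lra.
Unshelve. all: by end_near. Qed.

Lemma limit_within_inj T (x u v : X) :
  limit_within S T x u -> limit_within S T x v -> u = v.
Proof.
have PF := within_dense_proper x dS.
by apply: cvg_unique; exact: norm_hausdorff.
Qed.

(** [T'] tends to [x] at [u], and [T] tends to [u] at some [y]. Composing, [T' (T p) = p] tends to
    [x] as [p] tends to [y], so [x = y]. *)
Lemma step_inverse_limits T T' x : step_inverse S T T' ->
  exists u, limit_within S T x u /\ limit_within S T' u x.
Proof.
move=> TT'; have [u T'ux] := step_inverse_limit x TT'; exists u; split=> //.
have [y Tyu] := step_inverse_limit u (step_inverse_sym TT').
suff -> : x = y by [].
have PF := within_dense_proper y dS.
have [ST _ TK _ _] := TT'.
suff : limit_within S id y x.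
  move=> /limit_within_inj; apply; exact: cvg_within.
move/limit_withinP: Tyu => Tyu; move/limit_withinP: T'ux => T'ux.
apply/limit_withinP => e /T'ux[d /Tyu[d' d'0 Td'] T'd]; exists d' => // p Sp py.
by rewrite -(TK p Sp); apply: T'd; [exact: ST|exact: Td'].
Qed.

Lemma limit_within_le T T' (k : nat) x y u v : step_inverse S T T' ->
  limit_within S T x u -> limit_within S T y v ->
  `|x - y| < k%:R -> `|u - v| <= k%:R.
Proof.
move=> [_ _ _ _ Tk] /limit_withinP Txu /limit_withinP Tyv xy.
apply/ler_addgt0Pr => e e0.
have [d d0 Td] : exists2 d : R, 0 < d & forall p, S p -> `|p - x| < d -> `|T p - u| < e / 2.
  by apply: Txu; lra.
have [d' d'0 Td'] : exists2 d : R, 0 < d & forall p, S p -> `|p - y| < d -> `|T p - v| < e / 2.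
  by apply: Tyv; lra.
have r0 : 0 < (k%:R - `|x - y|) / 2 by lra.
have [p Sp] : exists2 p, S p & `|p - x| < Num.min d ((k%:R - `|x - y|) / 2).
  by apply: dense_ball => //; rewrite lt_min d0.
rewrite lt_min => /andP[/(Td _ Sp) pu px].
have [q Sq] : exists2 q, S q & `|q - y| < Num.min d' ((k%:R - `|x - y|) / 2).
  by apply: dense_ball => //; rewrite lt_min d'0.
rewrite lt_min => /andP[/(Td' _ Sq) qv qy].
have : `|p - q| < k%:R.
  have := ler_normD (p - x) (x - q); have := ler_normD (x - y) (y - q).
  by rewrite !subrKA (distrC y); lra.
rewrite (Tk k) //.
have := ler_normD (u - T p) (T p - v); have := ler_normD (T p - T q) (T q - v).
by rewrite !subrKA (distrC u (T p)); lra.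
Qed.

Lemma limit_within_lt T T' (k : nat) x y u v : step_inverse S T T' ->
  limit_within S T x u -> limit_within S T y v -> limit_within S T' v y ->
  `|x - y| < k%:R -> `|u - v| < k%:R.
Proof.
move=> TT' Txu Tyv T'vy xy.
have k0 : 0 < k%:R :> R by apply: le_lt_trans xy.
rewrite lt_neqAle (limit_within_le TT' Txu Tyv xy) andbT; apply/eqP => uvk.
move/limit_withinP : (T'vy) => /(_ ((k%:R - `|x - y|) / 2))[|d d0 T'd]; first lra.
(* If [|u - v| = k], then [v'] lies [d / 2] beyond [v] on the ray from [u]. The limit [y'] of [T']
   at [v'] is still closer than [k] to [x], so the weak inequality gives [|u - v'| <= k], although
   [|u - v'| = k + d / 2]. *)
pose v' := v + (d / 2 / k%:R) *: (v - u).
have v'v : `|v' - v| = d / 2.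
  rewrite /v' addrAC subrr add0r normrZ (distrC v) uvk ger0_norm ?divfK ?gt_eqF//.
  by rewrite !divr_ge0//; lra.
have [y' [T'v'y' Ty'v']] := step_inverse_limits v' (step_inverse_sym TT').
have y'y : `|y' - y| <= (k%:R - `|x - y|) / 2.
  apply/ler_addgt0Pr => e e0.
  move/limit_withinP : T'v'y' => /(_ e e0)[c c0 T'c].
  have [q Sq] : exists2 q, S q & `|q - v'| < Num.min c (d / 2).
    by apply: dense_ball => //; rewrite lt_min c0; lra.
  rewrite lt_min => /andP[/(T'c _ Sq) qy' qv'].
  have := ler_normD (y' - T' q) (T' q - y); rewrite subrKA (distrC y' (T' q)).
  have : `|T' q - y| < (k%:R - `|x - y|) / 2.
    apply: T'd => //; have := ler_normD (q - v') (v' - v).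
    by rewrite subrKA v'v; lra.
  by lra.
have /(limit_within_le TT' Txu Ty'v') : `|x - y'| < k%:R.
  by have := ler_normD (x - y) (y - y'); rewrite subrKA (distrC y); lra.
have -> : u - v' = (1 + d / 2 / k%:R) *: (u - v).
  by rewrite /v' scalerDl scale1r opprD addrA -scalerN opprB.
rewrite normrZ uvk ger0_norm; last by rewrite addr_ge0// !divr_ge0//; lra.
by rewrite mulrDl mul1r divfK ?gt_eqF//; lra.
Qed.

Lemma step_inverse_extension T T' : step_inverse S T T' ->
  exists Tbar Tbar', step_inverse setT Tbar Tbar' /\
    forall x, limit_within S T x (Tbar x).
Proof.
move=> TT'; have T'T := step_inverse_sym TT'.
have /choice[f fP] x := step_inverse_limits x TT'.
have /choice[g gP] x := step_inverse_limits x T'T.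
exists f, g; split; last by move=> x; have [] := fP x.
split=> // [x _|x _|k x y _ _].
- exact: limit_within_inj (gP (f x)).1 (fP x).2.
- exact: limit_within_inj (fP (g x)).1 (gP x).2.
have [[? ?] [? ?]] := (fP x, fP y).
by apply/idP/idP; [apply: (limit_within_lt TT')|apply: (limit_within_lt T'T)].
Qed.

Lemma step_inverse_limit_eq T T' x u : step_inverse S T T' -> S x ->
  limit_within S T x u -> T x = u.
Proof.
move=> TT' Sx; apply: limit_within_inj.
exact: (step_inverse_continuous TT' Sx).
Qed.

End step_inverse.

Theorem theorem20 (R : realType) (X : completeNormedModType R)
    (S : set X) (T : X -> X) :
  reflexive_space X -> dense S -> step_isometry S T ->
  exists! Tbar : X -> X, step_isometry [set: X] Tbar /\ {in S, Tbar =1 T}.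
Proof.
move=> reflX dS /step_isometry_inverse[T' TT'].
have dT : dense [set: X] by move=> O [x Ox] _; exists x.
have [f [g [fg Tf]]] := step_inverse_extension reflX dS TT'.
exists f; split.
  split; first by apply/step_isometry_inverse; exists g.
  by move=> x; rewrite inE => Sx; rewrite (step_inverse_limit_eq reflX dS TT' Sx (Tf x)).
(* Uniqueness: [h] is continuous, by the continuity lemma with the whole space as dense set, and
   agrees with [T] on [S], so [h x] is the limit of [T] at [x]. *)
move=> h [/step_isometry_inverse[h' hh'] hT]; apply/funext => x.
apply: limit_within_inj (Tf x) _ => //.
apply/limit_withinP => e.
move/limit_withinP: (step_inverse_continuous reflX dT hh' (I : setT x)).
move=> H /H[d d0 hd]; exists d => // p Sp px.
by rewrite -hT ?inE//; exact: hd.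
Qed.
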